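(* Let $d\ge32$, let $\mathcal{B}$ be a family of eight-element subsets of the $d$ coordinates with $|B\cap B'|\le4$ for distinct $B,B'\in\mathcal{B}$, and let $X\subset\mathbb{R}^d$ be the three-layer configuration of squared norm $32$ built from $\mathcal{B}$ (defined in the context). Let $Q\subset\{0,\pm1\}^{d}$ consist of distinct weight-eight vectors with $q\cdot q'\le4$ for all distinct $q,q'\in Q$, and let $\mathcal{D}\subseteq\mathcal{B}$. Deleting from $X$ the complete middle-layer bundles on the blocks of $\mathcal{D}$ and adjoining $2Q=\{2q:q\in Q\}$ preserves the kissing condition and changes the cardinality by $|Q|-128|\mathcal{D}|$ if and only if $$|\operatorname{supp}(q)\cap B|\le4\qquad\text{for all }q\in Q,\ B\in\mathcal{B}\setminus\mathcal{D}.$$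
   Context: The weight of a vector is its number of nonzero coordinates, and $\operatorname{supp}$ denotes the set of nonzero coordinates. The configuration $X$ has three layers, all vectors having squared norm $32$: (1) top layer: the $2^{17}$ vectors $((-1)^{c_0},\dots,(-1)^{c_{31}},0,\dots,0)\in\mathbb{R}^d$, where $c$ runs over a binary linear code with parameters $[32,17,8]$ (length 32, dimension 17, minimum distance 8); (2) middle layer: for each $B\in\mathcal{B}$, the bundle on $B$ consists of the $128$ vectors with support $B$, all nonzero entries $\pm2$, and a fixed sign parity (the product of the signs equals a prescribed value in $\{\pm1\}$ for that bundle); (3) root layer: all vectors with exactly two nonzero entries, each equal to $\pm4$. For a set of vectors of common squared norm $32$, the kissing condition is that distinct vectors have inner product at most $16$; $X$ satisfies it. *)

(* Defs.v *)
From mathcomp Require Import all_boot all_order all_algebra finmap.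
From mathcomp Require Import boolp classical_sets functions cardinality reals.

Set Implicit Arguments.
Unset Strict Implicit.
Unset Printing Implicit Defensive.

Import Order.TTheory GRing.Theory Num.Theory.

Local Open Scope ring_scope.

Definition hamming_dist (n : nat) (x y : 'rV['F_2]_n) : nat :=
  #|finset (fun i => x 0 i != y 0 i)|.

(* C is a binary linear code with parameters [n, k, delta]; delta is the exact
   minimum distance, not only a lower bound. *)
Definition binary_code (n k delta : nat) (C : {vspace 'rV['F_2]_n}) : Prop :=
  [/\ \dim C = k,
      forall x y, x \in C -> y \in C -> x != y ->
        (delta <= hamming_dist x y)%N
    & exists x y, [/\ x \in C, y \in C, x != y & hamming_dist x y = delta]].

Arguments binary_code : clear implicits.

Section Vectors.
Variables (R : realType) (d : nat).
Implicit Types (u v : 'rV[R]_d) (S : set 'rV[R]_d).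

Definition dot u v : R := \sum_i u 0 i * v 0 i.

Definition supp v : {set 'I_d} := finset (fun i => v 0 i != 0).

Definition weight v : nat := #|supp v|.

Definition kissing S : Prop :=
  (forall u, S u -> dot u u = 32) /\
  (forall u v, S u -> S v -> u != v -> dot u v <= 16).

(* Only meaningful for finite S, since fset_set is empty on infinite sets; every
   S it is applied to is finite, see finite_configuration and finite_exchange. *)
Definition cardinal S : nat := #|` fset_set S|.

End Vectors.

Section Configuration.
Variables (R : realType) (d : nat).
Local Open Scope classical_set_scope.

(* For i < 32, inord i : 'I_32 is i itself. *)
Definition top_vector (c : 'rV['F_2]_32) : 'rV[R]_d :=
  \row_(i < d) (if (i < 32)%N then (-1) ^+ nat_of_ord (c 0 (inord i)) else 0).

Definition top_layer (C : {vspace 'rV['F_2]_32}) : set 'rV[R]_d :=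
  [set top_vector c | c in [set` C]].

Definition bundle (eps : {set 'I_d} -> R) (B : {set 'I_d}) : set 'rV[R]_d :=
  [set v | [/\ supp v = B,
               forall i, i \in B -> v 0 i = 2 \/ v 0 i = -2
             & \prod_(i in B) Num.sg (v 0 i) = eps B]].

Definition bundles (eps : {set 'I_d} -> R) (Bs : {set {set 'I_d}}) :
    set 'rV[R]_d :=
  \bigcup_(B in [set` Bs]) bundle eps B.

Definition root_layer : set 'rV[R]_d :=
  [set v | weight v = 2%N /\
           forall i, i \in supp v -> v 0 i = 4 \/ v 0 i = -4].

Definition configuration (C : {vspace 'rV['F_2]_32}) (eps : {set 'I_d} -> R)
    (Bs : {set {set 'I_d}}) : set 'rV[R]_d :=
  top_layer C `|` bundles eps Bs `|` root_layer.

Definition exchange (C : {vspace 'rV['F_2]_32}) (eps : {set 'I_d} -> R)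
    (Bs Ds : {set {set 'I_d}}) (Q : {fset 'rV[R]_d}) : set 'rV[R]_d :=
  (configuration C eps Bs `\` bundles eps Ds) `|` [set 2 *: q | q in [set` Q]].

Lemma finite_entries (s : seq R) :
  finite_set [set v : 'rV[R]_d | forall i, v 0 i \in s].
Proof.
pose g (f : {ffun 'I_d -> 'I_(size s).+1}) : 'rV[R]_d := \row_i s`_(f i).
apply: (@sub_finite_set _ _ (g @` setT)); last exact/finite_image/finite_finset.
move=> v /= sv; exists [ffun i => inord (index (v 0 i) s)] => //.
apply/rowP => i; rewrite mxE ffunE inordK ?nth_index//.
by rewrite ltnS index_size.
Qed.

Lemma finite_configuration (C : {vspace 'rV['F_2]_32}) (eps : {set 'I_d} -> R)
  (Bs : {set {set 'I_d}}) : finite_set (configuration C eps Bs).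
Proof.
apply: sub_finite_set (finite_entries [:: 0; 1; -1; 2; -2; 4; -4]) => v.
have out i : i \notin supp v -> v 0 i = 0 by rewrite inE negbK => /eqP.
move=> [[[c _ <-]|[B _ [vB v2 _]]]|[_ v4]] i.
- rewrite mxE; case: ifP => _; last by rewrite inE eqxx.
  by rewrite -signr_odd; case: (odd _); rewrite !inE eqxx ?orbT.
- have [iB|iB] := boolP (i \in B).
    by case: (v2 i iB) => ->; rewrite !inE eqxx ?orbT.
  by rewrite out ?vB// inE eqxx.
- have [iv|iv] := boolP (i \in supp v).
    by case: (v4 i iv) => ->; rewrite !inE eqxx ?orbT.
  by rewrite out// inE eqxx.
Qed.

Lemma finite_exchange (C : {vspace 'rV['F_2]_32}) (eps : {set 'I_d} -> R)
  (Bs Ds : {set {set 'I_d}}) (Q : {fset 'rV[R]_d}) :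
  finite_set (exchange C eps Bs Ds Q).
Proof.
rewrite finite_setU; split; first exact/finite_setD/finite_configuration.
exact/finite_image/finite_fset.
Qed.

End Configuration.

(* Main.v *)
(* All vectors involved are flat: their nonzero entries have a constant absolute
   value.  Hence the inner product of flat vectors of heights a and b is at most
   a b times the size of the common support, and for equal heights and supports it
   is determined by the number of differing signs; this gives all kissing bounds.
   Conversely, if a support meets a retained block B in more than four points, some
   vector v of the bundle on B has 2q.v >= 20.  Either v <> 2q, violating the kissing
   condition, or 2q = v was already present, violating the cardinality equation. *)
Require Import Defs.
From mathcomp Require Import all_boot all_order all_algebra finmap.
From mathcomp Require Import boolp classical_sets functions cardinality reals.
From mathcomp Require Import lra zify.

Set Implicit Arguments.
Unset Strict Implicit.
Unset Printing Implicit Defensive.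

Import Order.TTheory GRing.Theory Num.Theory.

Local Open Scope ring_scope.

(** * Flat vectors and their inner products *)

Lemma eq_opp (R : realType) (x : R) : (x == - x) = (x == 0).
Proof. by rewrite eq_sym eqNr. Qed.

(** The factor [*+ (i \in A)] encodes both cases at once: absolute value [a] on [A] and zero off
    [A]. *)
Definition flat {R : realType} {d : nat} (a : R) (A : {set 'I_d}) (v : 'rV[R]_d) :=
  forall i, `|v 0 i| = a *+ (i \in A).

Section Flat.
Variables (R : realType) (d : nat).
Implicit Types (a b : R) (A B : {set 'I_d}) (u v : 'rV[R]_d).

Definition diff_set u v : {set 'I_d} := finset (fun i => u 0 i != v 0 i).

Lemma flatP a A v : 0 <= a ->
  (forall i, i \in A -> v 0 i = a \/ v 0 i = - a) ->
  (forall i, i \notin A -> v 0 i = 0) -> flat a A v.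
Proof.
move=> a0 vA v0 i; have [iA|iA] := boolP (i \in A); last by rewrite v0// normr0.
by case: (vA i iA) => ->; rewrite ?normrN ger0_norm.
Qed.

Lemma flat_supp a A v : a != 0 -> flat a A v -> supp v = A.
Proof.
move=> a0 vA; apply/setP => i; rewrite inE -normr_eq0 vA.
by case: (i \in A); rewrite ?mulr1n ?mulr0n ?a0 ?eqxx.
Qed.

(** A nonzero height can be read off at any point of the support; this is what tells vectors of
    different layers apart. *)
Lemma flat_inj a b A B v : a != 0 -> flat a A v -> flat b B v -> A != finset.set0 -> a = b.
Proof.
move=> a0 vA vB /finset.set0Pn[i iA]; have := vB i; rewrite vA iA.
by case: (i \in B) => //; rewrite mulr1n mulr0n => /eqP; rewrite (negPf a0).
Qed.

Lemma dot_flat_le a b A B u v : flat a A u -> flat b B v ->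
  dot u v <= a * b *+ #|A :&: B|.
Proof.
move=> uA vB; rewrite -sumr_const big_mkcond /=.
apply: ler_sum => i _; apply: le_trans (ler_norm _) _.
rewrite normrM uA vB inE.
by case: (i \in A); case: (i \in B); rewrite ?mulr1n ?mulr0n ?mul0r ?mulr0.
Qed.

(** Each coordinate in [A] contributes [a ^+ 2] if the signs agree and [- a ^+ 2] if they differ, a
    loss of twice [a ^+ 2]. Off [A] both vectors vanish, so they differ only inside [A]. *)
Lemma dot_flat a A u v : flat a A u -> flat a A v ->
  dot u v = a ^+ 2 *+ #|A| - a ^+ 2 *+ 2 *+ #|diff_set u v|.
Proof.
move=> uA vA; rewrite -!sumr_const [X in _ = X - _]big_mkcond [X in _ = _ - X]big_mkcond -sumrB.
apply: eq_bigr => i _; rewrite inE.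
have := uA i; have := vA i; have [iA|iA] := boolP (i \in A); last first.
  by rewrite mulr0n => /eqP; rewrite normr_eq0 => /eqP-> /eqP;
    rewrite normr_eq0 => /eqP->; rewrite eqxx mulr0 subr0.
rewrite mulr1n => va ua; rewrite -va.
have [->|uv] := eqVneq (u 0 i) (v 0 i).
  by rewrite subr0 -expr2 -normrX ger0_norm// sqr_ge0.
have : `|u 0 i| == `|v 0 i| by rewrite ua va.
rewrite eqr_norm2 (negPf uv) => /eqP->.
by rewrite mulNr -normrX ger0_norm ?sqr_ge0//= expr2 mulr2n opprD addNKr.
Qed.

Lemma dot_flat_self a A u : flat a A u -> dot u u = a ^+ 2 *+ #|A|.
Proof.
move=> uA; rewrite (dot_flat uA uA) [X in _ *+ 2 *+ X]eq_card0 ?subr0// => i.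
by rewrite inE eqxx.
Qed.

Lemma flat_diff_gt0 u v : u != v -> (0 < #|diff_set u v|)%N.
Proof.
move=> uv; rewrite card_gt0; apply: contraNneq uv => D0; apply/eqP/rowP => i.
by apply/eqP; have := finset.in_set0 i; rewrite -D0 inE => /negbFE.
Qed.
End Flat.

(** * Parametrization of bundles by sets of negative positions, and their cardinality *)

Section SignVector.
Variables (R : realType) (d : nat).
Implicit Types (B S : {set 'I_d}) (v : 'rV[R]_d) (eps : {set 'I_d} -> R).
Local Open Scope classical_set_scope.

Definition sign_vector B S : 'rV[R]_d :=
  \row_i (if i \in B then (if i \in S then -2 else 2) else 0).

(** The product of the signs is -1 to the number of negative entries, so the prescribed value of
    [eps B] fixes the parity of [#|S|]. *)
Definition parity_subsets eps B : {set {set 'I_d}} :=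
  finset (fun S : {set 'I_d} => (S \subset B) && (odd #|S| == (eps B == -1))).

(** Putting [j] in or leaving it out switches the parity and affects no other point. This serves
    both to count a bundle and to find a bundle vector with signs prescribed away from [j]. *)
Lemma exists_parity_subset B S j (b : bool) : j \in B -> S \subset B ->
  exists S', [/\ S' \subset B, odd #|S'| = b & S' :\ j = S :\ j]%SET.
Proof.
move=> jB SB; have S'B : S :\ j \subset B by apply: fintype.subset_trans SB; apply: finset.subsetDl.
have [<-|] := eqVneq (odd #|S :\ j|) b.
  exists (S :\ j)%SET; split=> //; apply/setP => i; rewrite !inE.
  by case: eqP.
move=> ob; exists (j |: S :\ j)%SET; split.
- by rewrite finset.subUset finset.sub1set jB.
- by rewrite cardsU1 !inE eqxx /=; move: ob; case: (odd _) b => -[].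
- by apply/setP => i; rewrite !inE; case: eqP.
Qed.

(** Deleting a fixed point [j] of [B] is a bijection onto the subsets of [B :\ j], since the parity
    decides whether [j] belongs to the set. *)
Lemma card_parity_subsets eps B : B != finset.set0 ->
  #|parity_subsets eps B| = (2 ^ #|B|.-1)%N.
Proof.
move=> /finset.set0Pn[j jB].
rewrite [#|B|](cardsD1 j) jB /= -card_powerset.
have <- : ((fun S => S :\ j) @: parity_subsets eps B)%SET = finset.powerset (B :\ j).
  apply/setP => T; rewrite [RHS]inE; apply/imsetP/idP.
    by move=> [S]; rewrite inE => /andP[SB _] ->; apply: finset.setSD.
  move=> TB; have TB' := fintype.subset_trans TB (finset.subsetDl _ _).
  have [S [SB oS ST]] := exists_parity_subset (eps B == -1) jB TB'.
  exists S; first by rewrite inE SB oS eqxx.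
  rewrite ST; apply/setP => i; rewrite !inE.
  by case: eqP => //= ->; apply/negP => /(fintype.subsetP TB); rewrite !inE eqxx.
rewrite card_in_imset// => S S'; rewrite !inE => /andP[_ /eqP oS] /andP[_ /eqP oS'] SS'.
have jSS' : (j \in S) = (j \in S').
  move: oS'; rewrite -oS (cardsD1 j S) (cardsD1 j S') SS' !oddD.
  by move/addIb; case: (j \in S); case: (j \in S').
apply/setP => i; have [->//|ij] := eqVneq i j.
by have /setP/(_ i) := SS'; rewrite !inE ij.
Qed.

Lemma sign_vector_flat B S : flat 2 B (sign_vector B S).
Proof.
apply: flatP => // i iB; rewrite mxE ?iB ?(negPf iB)//.
by case: (i \in S); [right|left].
Qed.

Lemma supp_sign_vector B S : supp (sign_vector B S) = B.
Proof. by apply: flat_supp (sign_vector_flat B S); rewrite pnatr_eq0. Qed.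

Lemma sign_vector_inj B S S' : S \subset B -> S' \subset B ->
  sign_vector B S = sign_vector B S' -> S = S'.
Proof.
move=> SB S'B /rowP e; apply/setP => i; have := e i; rewrite !mxE.
have [iB|iB] := boolP (i \in B); last first.
  by rewrite (contraNF (fintype.subsetP SB i))// (contraNF (fintype.subsetP S'B i)).
by case: (i \in S); case: (i \in S') => // /eqP; rewrite ?eqNr ?eq_opp pnatr_eq0.
Qed.

Lemma bundle_sign_vector eps B S : S \subset B -> eps B = 1 \/ eps B = -1 ->
  bundle eps B (sign_vector B S) <-> S \in parity_subsets eps B.
Proof.
move=> SB epsB; have sgS : \prod_(i in B) Num.sg (sign_vector B S 0 i) = (-1) ^+ odd #|S|.
  rewrite signr_odd -prodr_const (big_setID S)/= (finset.setIidPr SB).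
  rewrite [X in _ * X]big1 ?mulr1.
    apply: eq_bigr => i iS; rewrite mxE (fintype.subsetP SB)// iS.
    by rewrite sgrN gtr0_sg.
  move=> i; rewrite inE => /andP[iS iB].
  by rewrite mxE iB (negPf iS) gtr0_sg.
rewrite inE SB /=; split=> [[_ _]|oS].
  rewrite sgS => <-; case: (odd _); first by rewrite expr1 eqxx.
  by rewrite expr0 eq_opp oner_eq0.
split; first exact: supp_sign_vector.
  move=> i iB; rewrite mxE iB.
  by case: (i \in S); [right|left].
rewrite sgS (eqP oS); case: epsB => ->; last by rewrite eqxx.
by rewrite eq_opp oner_eq0.
Qed.

Lemma bundleE eps B : eps B = 1 \/ eps B = -1 ->
  bundle eps B = [set sign_vector B S | S in [set` parity_subsets eps B]].
Proof.
move=> epsB; apply/seteqP; split=> [v Bv|_ [S /= Spar] <-]; last first.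
  by apply/bundle_sign_vector => //; move: Spar; rewrite inE => /andP[].
(* The set of negative positions of [v] recovers it as a sign vector. *)
pose S : {set 'I_d} := finset (fun i => v 0 i == -2).
have [vB v2 _] := Bv.
have SB : S \subset B.
  apply/fintype.subsetP => i; rewrite -vB !inE => /eqP->.
  by rewrite oppr_eq0 pnatr_eq0.
have vS : sign_vector B S = v.
  apply/rowP => i; rewrite mxE inE; have [iB|] := boolP (i \in B); last first.
    by rewrite -vB inE negbK => /eqP->.
  case: (v2 i iB) => ->; last by rewrite eqxx.
  by rewrite eq_opp pnatr_eq0.
by exists S => //=; apply/bundle_sign_vector => //; rewrite vS.
Qed.

(** The vectors correspond bijectively to pairs of a block and a subset of the right parity: the
    block is the support, the subset the negative positions. Each block has [2 ^ 7] such subsets. *)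
Lemma cardinal_bundles eps (Ds : {set {set 'I_d}}) :
  (forall B, B \in Ds -> #|B| = 8%N) ->
  (forall B, B \in Ds -> eps B = 1 \/ eps B = -1) ->
  cardinal (bundles eps Ds) = (128 * #|Ds|)%N.
Proof.
move=> Ds8 epsD.
pose P : {set {set 'I_d} * {set 'I_d}} :=
  finset (fun p => (p.1 \in Ds) && (p.2 \in parity_subsets eps p.1)).
have -> : bundles eps Ds = [set sign_vector p.1 p.2 | p in [set` [fset p in P]%fset]].
  apply/seteqP; split=> [v [B /= BD]|_ [p /= + <-]].
    rewrite (bundleE (epsD _ BD)) => -[S /= SB <-].
    by exists (B, S) => //=; rewrite !inE BD /=; move: SB; rewrite inE.
  rewrite !inE /= => /andP[pD pP]; exists p.1 => //=.
  by rewrite (bundleE (epsD _ pD)); exists p.2 => //=; rewrite inE.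
rewrite /cardinal fset_set_image ?finite_fset// set_fsetK card_in_imfset/=; last first.
  move=> [B S] [B' S']; rewrite !inE /= => /andP[_ /andP[SB _]] /andP[_ /andP[S'B _]] e.
  have BB' : B = B' by rewrite -(supp_sign_vector B S) e supp_sign_vector.
  by subst B'; rewrite (sign_vector_inj SB S'B e).
rewrite card_finset -sum1_card.
rewrite (eq_bigl (fun p => (p.1 \in Ds) && (p.2 \in parity_subsets eps p.1))); last first.
  by move=> p; rewrite inE.
rewrite -(pair_big_dep (mem Ds) (fun B S => S \in parity_subsets eps B) (fun _ _ => 1%N)) /=.
rewrite mulnC -sum_nat_const; apply: eq_bigr => B BD.
by rewrite sum1_card card_parity_subsets ?Ds8// -card_gt0 Ds8.
Qed.

Lemma cardinalUI (A B : set 'rV[R]_d) : finite_set A -> finite_set B ->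
  (cardinal (A `|` B) + cardinal (A `&` B) = cardinal A + cardinal B)%N.
Proof. by move=> fA fB; rewrite /cardinal fset_setU// fset_setI// cardfsUI. Qed.

End SignVector.

(** * Inner products within and between the layers *)

Section Layers.
Variables (R : realType) (d : nat).
Implicit Types (A B : {set 'I_d}) (u v : 'rV[R]_d).

Lemma dotC u v : dot u v = dot v u.
Proof. by apply: eq_bigr => i _; rewrite mulrC. Qed.

Lemma dot_flat_bound a b c n A B u v : 0 <= a -> 0 <= b -> flat a A u -> flat b B v ->
  (#|A :&: B| <= n)%N -> a * b * n%:R <= c -> dot u v <= c.
Proof.
move=> a0 b0 uA vB ABn; apply: le_trans; apply: le_trans (dot_flat_le uA vB) _.
by rewrite mulr_natr ler_wpMn2l ?mulr_ge0.
Qed.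

Definition top_support : {set 'I_d} := finset (fun i : 'I_d => (i < 32)%N).

Lemma top_vector_flat (c : 'rV['F_2]_32) : flat (1 : R) top_support (top_vector R d c).
Proof. by move=> i; rewrite mxE inE; case: ifP; rewrite ?normr0// normrX normrN1 expr1n. Qed.

Lemma sign_F2_inj : injective (fun x : 'F_2 => (-1 : R) ^+ x).
Proof.
move=> x y; case: x => [[|[|//]] xP]; case: y => [[|[|//]] yP]; rewrite /= ?expr0 ?expr1.
- by move=> _; apply: val_inj.
- by move/eqP; rewrite eq_opp oner_eq0.
- by move/eqP; rewrite eqNr oner_eq0.
- by move=> _; apply: val_inj.
Qed.

Hypothesis hd : (32 <= d)%N.

Let widen_inj : injective (widen_ord hd).
Proof. by move=> i j /(congr1 val)/= ij; apply: val_inj. Qed.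

Lemma card_top_support : #|top_support| = 32%N.
Proof.
rewrite -[RHS]card_ord -cardsT -(card_imset _ widen_inj).
apply: eq_card => i; rewrite inE; apply/idP/imsetP => [i32|[j _ ->]]; last exact: (ltn_ord j).
by exists (Ordinal i32); [rewrite inE | apply: val_inj].
Qed.

(** Distinct bits give distinct signs, so the codeword positions that differ, embedded in the first
    32 coordinates, are exactly the places where the vectors differ. *)
Lemma card_diff_top_vector (c c' : 'rV['F_2]_32) :
  #|diff_set (top_vector R d c) (top_vector R d c')| = hamming_dist c c'.
Proof.
rewrite /hamming_dist -(card_imset _ widen_inj).
apply: eq_card => i; rewrite inE !mxE; apply/idP/imsetP => [|[j]].
  case: ifP => [i32|]; last by rewrite eqxx.
  move=> cc'; exists (inord i); last by apply: val_inj; rewrite /= inordK.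
  by rewrite inE; apply: contraNneq cc' => ->.
by rewrite inE => cc' -> /=; rewrite ltn_ord inord_val (inj_eq sign_F2_inj).
Qed.

(** The inner product is 32 minus twice the Hamming distance, which is at least 8. *)
Lemma dot_top_vector (C : {vspace 'rV['F_2]_32}) k c c' : binary_code 32 k 8 C ->
  c \in C -> c' \in C -> c != c' -> dot (top_vector R d c) (top_vector R d c') <= 16.
Proof.
move=> [_ C8 _] cC c'C cc'; have := C8 _ _ cC c'C cc'.
rewrite (dot_flat (top_vector_flat c) (top_vector_flat c')).
rewrite card_top_support card_diff_top_vector => h8.
have : (8%:R : R) <= (hamming_dist c c')%:R by rewrite ler_nat.
by rewrite expr1n -mulr_natr -[1 *+ 2 *+ _]mulr_natr; lra.
Qed.

Lemma bundle_flat (eps : {set 'I_d} -> R) B v : bundle eps B v -> flat 2 B v.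
Proof.
move=> [vB v2 _]; apply: flatP => // i iB.
by apply/eqP; rewrite -vB inE negbK in iB.
Qed.

Lemma root_flat v : root_layer v -> flat 4 (supp v) v /\ #|supp v| = 2%N.
Proof.
move=> [w v4]; split=> //; apply: flatP => // i.
by rewrite inE negbK => /eqP.
Qed.

(** The inner product is 32 minus 8 per differing sign, so two differences suffice; a single one
    would change the product of the signs. *)
Lemma dot_bundle (eps : {set 'I_d} -> R) B u v : #|B| = 8%N ->
  bundle eps B u -> bundle eps B v -> u != v -> dot u v <= 16.
Proof.
move=> B8 Bu Bv uv; rewrite (dot_flat (bundle_flat Bu) (bundle_flat Bv)) B8.
suff : (1 < #|diff_set u v|)%N.
  rewrite -(ler_nat R) -[_ *+ #|_|]mulr_natr; lra.
rewrite ltn_neqAle flat_diff_gt0// andbT; apply: contraTneq isT => /esym/eqP/cards1P[j Dj].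
have D i : (u 0 i != v 0 i) = (i == j).
  by have /setP/(_ i) := Dj; rewrite !inE.
have jB : j \in B.
  apply: contraT => jB; have := D j; rewrite eqxx.
  have := bundle_flat Bu j; have := bundle_flat Bv j.
  rewrite (negPf jB) !mulr0n => /eqP; rewrite normr_eq0 => /eqP->.
  by move=> /eqP; rewrite normr_eq0 => /eqP->; rewrite eqxx.
have [[_ u2 epsu] [_ v2 epsv]] := (Bu, Bv).
have := epsu; rewrite -epsv !(bigD1 j jB) /=.
rewrite [X in _ * X](eq_bigr (fun i => Num.sg (v 0 i))); last first.
  by move=> i /andP[_ ij]; have := D i; rewrite (negPf ij) => /negbFE/eqP->.
(* The signs away from [j] agree and have a nonzero product; cancelling it forces agreement at [j]
   as well. *)
move/mulIf => sguv; have /eqP := D j; rewrite eqxx.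
suff /eqP : Num.sg (u 0 j) = Num.sg (v 0 j).
  case: (u2 j jB) => ->; case: (v2 j jB) => ->; rewrite ?eqxx//.
    by rewrite sgrN gtr0_sg// eq_opp oner_eq0.
  by rewrite sgrN gtr0_sg// eqNr oner_eq0.
apply: sguv; apply/prodf_neq0 => i /andP[iB _].
by rewrite sgr_eq0; case: (v2 i iB) => ->; rewrite ?oppr_eq0 pnatr_eq0.
Qed.

(** For equal supports the value is 32 minus 32 per differing sign, hence at most 0. Distinct
    two-point supports share at most one coordinate, giving at most 4 times 4. *)
Lemma dot_root u v : root_layer u -> root_layer v -> u != v -> dot u v <= 16.
Proof.
move=> /root_flat[u4 u2] /root_flat[v4 v2] uv.
have [suv|suv] := eqVneq (supp u) (supp v).
  rewrite -suv in v4; rewrite (dot_flat u4 v4) u2 -[_ *+ #|_|]mulr_natr.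
  by have := flat_diff_gt0 uv; rewrite -(ler_nat R); lra.
apply: (dot_flat_bound (n := 1) _ _ u4 v4); [by [] | by [] | | lra].
rewrite -ltnS -u2; apply: proper_card; rewrite properEcard finset.subsetIl /=.
rewrite ltn_neqAle subset_leq_card ?finset.subsetIl// andbT.
apply: contraNneq suv => I2.
have uSv : supp u \subset supp v.
  by apply/finset.setIidPl/eqP; rewrite eqEcard finset.subsetIl I2 leqnn.
by rewrite eqEcard uSv u2 v2.
Qed.

Lemma dot_top_le (c : 'rV['F_2]_32) A v : #|A| = 8%N -> flat 2 A v ->
  dot (top_vector R d c) v <= 16.
Proof.
move=> A8 v2; apply: (dot_flat_bound (n := 8) _ _ (top_vector_flat c) v2) => //.
  by rewrite -A8 subset_leq_card// finset.subsetIr.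
by lra.
Qed.

Lemma dot_root_le a A u v : root_layer u -> 0 <= a -> a <= 2 -> flat a A v ->
  dot u v <= 16.
Proof.
move=> /root_flat[u4 u2] a0 a2 va.
apply: (dot_flat_bound (n := 2) _ _ u4 va) => //; last lra.
by rewrite -u2 subset_leq_card// finset.subsetIl.
Qed.

Lemma flat_scale2 (q : 'rV[R]_d) :
  (forall i, [\/ q 0 i = 0, q 0 i = 1 | q 0 i = -1]) -> flat 2 (supp q) (2 *: q).
Proof.
move=> q1; apply: flatP => // i; rewrite inE mxE.
  by case: (q1 i) => ->; rewrite ?eqxx// => _; [left|right]; rewrite ?mulr1 ?mulrN1.
by rewrite negbK => /eqP->; rewrite mulr0.
Qed.

Lemma dot_scale2 (q q' : 'rV[R]_d) : dot (2 *: q) (2 *: q') = 4 * dot q q'.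
Proof.
rewrite /dot mulr_sumr; apply: eq_bigr => i _; rewrite !mxE; lra.
Qed.

End Layers.

(** * Cardinality of the exchanged configuration *)

Section Exchange.
Variables (R : realType) (d : nat) (C : {vspace 'rV['F_2]_32}).
Variables (eps : {set 'I_d} -> R) (Bs Ds : {set {set 'I_d}}) (Q : {fset 'rV[R]_d}).
Local Open Scope classical_set_scope.

Hypothesis hDs : Ds \subset Bs.
Let retained := configuration C eps Bs `\` bundles eps Ds.
Let adjoined : set 'rV[R]_d := [set 2 *: q | q in [set` Q]].

Let finite_retained : finite_set retained.
Proof. exact/finite_setD/finite_configuration. Qed.

Let finite_adjoined : finite_set adjoined.
Proof. exact/finite_image/finite_fset. Qed.

Lemma bundles_sub : bundles eps Ds `<=` configuration C eps Bs.
Proof.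
move=> v [B /= BD Bv]; left; right; exists B => //=.
exact: (fintype.subsetP hDs).
Qed.

Lemma retainedP v : retained v ->
  [\/ exists2 c, c \in C & v = top_vector R d c,
      exists2 B, B \in Bs :\: Ds & bundle eps B v | root_layer v].
Proof.
move=> [[[[c cC <-]|[B /= BB Bv]]|rv] vD].
- by apply: Or31; exists c.
- apply: Or32; exists B => //; rewrite inE BB andbT.
  by apply/negP => BD; apply: vD; exists B.
- exact: Or33.
Qed.

(** A bundle vector determines its block as its support, so bundles on other blocks remove nothing
    from this one. *)
Lemma bundle_retained B : B \in Bs :\: Ds -> bundle eps B `<=` retained.
Proof.
rewrite inE => /andP[BD BB] v Bv; split; first by left; right; exists B.
move=> [B' /= B'D [vB' _ _]]; case: Bv => vB _ _.
by move: BD; rewrite -vB vB' B'D.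
Qed.

Hypothesis hBs8 : forall B : {set 'I_d}, B \in Bs -> #|B| = 8%N.
Hypothesis heps : forall B : {set 'I_d}, B \in Bs -> eps B = 1 \/ eps B = -1.

(** Inclusion-exclusion is applied to the deletion and then to the adjunction. The last term counts
    adjoined vectors that were present after the deletion, so the desired change of cardinality
    amounts to its vanishing. *)
Lemma cardinal_exchange :
  (cardinal (exchange C eps Bs Ds Q))%:Z - (cardinal (configuration C eps Bs))%:Z
    = (#|` Q|)%:Z - 128 * (#|Ds|)%:Z - (cardinal (retained `&` adjoined))%:Z.
Proof.
have DsP B : B \in Ds -> B \in Bs by exact: (fintype.subsetP hDs).
have cQ : cardinal adjoined = #|` Q|.
  rewrite /cardinal fset_set_image ?finite_fset// set_fsetK card_imfset//.
  by apply: scalerI; rewrite pnatr_eq0.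
have := cardinalUI finite_retained finite_adjoined.
have fD : finite_set (bundles eps Ds).
  exact: sub_finite_set bundles_sub (finite_configuration _ _ _).
have := cardinalUI finite_retained fD.
rewrite setDKI setDKU; last exact: bundles_sub.
rewrite cardinal_bundles => [|B /DsP /hBs8//|B /DsP /heps//].
have -> : cardinal (set0 : set 'rV[R]_d) = 0%N by rewrite /cardinal fset_set0 cardfs0.
rewrite cQ -/(exchange C eps Bs Ds Q); lia.
Qed.

(** * Kissing condition for the exchanged configuration, and the converse construction *)

Hypothesis hd : (32 <= d)%N.
Hypothesis hBs4 : forall B B' : {set 'I_d}, B \in Bs -> B' \in Bs -> B != B' ->
  (#|B :&: B'| <= 4)%N.
Variable k : nat.
Hypothesis hC : binary_code 32 k 8 C.
Hypothesis hQentries : forall q : 'rV[R]_d, q \in Q ->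
  forall i, [\/ q 0 i = 0, q 0 i = 1 | q 0 i = -1].
Hypothesis hQweight : forall q : 'rV[R]_d, q \in Q -> weight q = 8%N.
Hypothesis hQdot : forall q q' : 'rV[R]_d, q \in Q -> q' \in Q -> q != q' ->
  dot q q' <= 4.

Let retained_block B : B \in Bs :\: Ds -> B \in Bs.
Proof. by rewrite inE => /andP[]. Qed.

Lemma norm_retained v : retained v -> dot v v = 32.
Proof.
case/retainedP => [[c _ ->]|[B BD Bv]|/root_flat[v4 v2]].
- rewrite (dot_flat_self (top_vector_flat _ _)) card_top_support// -mulr_natr; lra.
- rewrite (dot_flat_self (bundle_flat Bv)) (hBs8 (retained_block BD)) -mulr_natr; lra.
- rewrite (dot_flat_self v4) v2 -mulr_natr; lra.
Qed.

Lemma dot_retained u v : retained u -> retained v -> u != v -> dot u v <= 16.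
Proof.
case/retainedP => [[c cC ->]|[B BD Bu]|ru];
  case/retainedP => [[c' c'C ->]|[B' BD' Bv]|rv] uv.
- by apply: (dot_top_vector R hd hC) => //; apply: contraNneq uv => ->.
- exact: dot_top_le (hBs8 (retained_block BD')) (bundle_flat Bv).
- by rewrite dotC; apply: dot_root_le rv _ _ (top_vector_flat _ _); lra.
- by rewrite dotC; apply: dot_top_le (hBs8 (retained_block BD)) (bundle_flat Bu).
- have [BB'|BB'] := eqVneq B B'.
    by subst B'; apply: (dot_bundle (hBs8 (retained_block BD)) Bu Bv uv).
  (* Heights 2 and 2 with at most four common coordinates give at most 16. *)
  apply: (dot_flat_bound (n := 4) _ _ (bundle_flat Bu) (bundle_flat Bv)) => //.
    exact: hBs4 (retained_block BD) (retained_block BD') BB'.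
  by lra.
- by rewrite dotC; apply: dot_root_le rv _ _ (bundle_flat Bu); lra.
- apply: dot_root_le ru _ _ (top_vector_flat _ _); lra.
- apply: dot_root_le ru _ _ (bundle_flat Bv); lra.
- exact: dot_root.
Qed.

Lemma dot_retained_adjoined v q : retained v -> q \in Q ->
  (forall B, B \in Bs :\: Ds -> (#|supp q :&: B| <= 4)%N) -> dot v (2 *: q) <= 16.
Proof.
move=> rv qQ q4; have fq := flat_scale2 (hQentries qQ).
case/retainedP: rv => [[c cC ->]|[B BD Bv]|rv].
- exact: dot_top_le (hQweight qQ) fq.
- rewrite dotC; apply: (dot_flat_bound (n := 4) _ _ fq (bundle_flat Bv)) => //.
    exact: q4.
  by lra.
- by apply: dot_root_le rv _ _ fq; lra.
Qed.

(** An adjoined vector has height 2, unlike the top and root vectors. In a retained bundle its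
    support would be the block itself, meeting it in eight points. *)
Lemma retained_adjoined_disjoint :
  (forall q B, q \in Q -> B \in Bs :\: Ds -> (#|supp q :&: B| <= 4)%N) ->
  retained `&` adjoined = set0.
Proof.
move=> Q4; apply/seteqP; split=> // v [rv [q /= qQ qv]].
have := flat_scale2 (hQentries qQ); rewrite qv => fq.
have q0 : supp q != finset.set0 by rewrite -card_gt0 [#|_|]hQweight.
have two0 : (2 : R) != 0 by rewrite pnatr_eq0.
case/retainedP: rv => [[c _ vE]|[B BD Bv]|/root_flat[v4 _]].
- have := flat_inj two0 fq _ q0; rewrite vE => /(_ _ _ (top_vector_flat _ _)); lra.
- have := Q4 _ _ qQ BD; have := flat_supp two0 (bundle_flat Bv).
  by rewrite (flat_supp two0 fq) => ->; rewrite finset.setIid (hBs8 (retained_block BD)).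
- by have := flat_inj two0 fq v4 q0; lra.
Qed.

Lemma kissing_exchange :
  (forall q B, q \in Q -> B \in Bs :\: Ds -> (#|supp q :&: B| <= 4)%N) ->
  kissing (exchange C eps Bs Ds Q).
Proof.
move=> Q4; split=> [u [/norm_retained//|[q /= qQ <-]]|u v].
  rewrite (dot_flat_self (flat_scale2 (hQentries qQ))) [#|_|]hQweight// -mulr_natr; lra.
case=> [ru|[q /= qQ <-]]; case=> [rv|[q' /= q'Q <-]] uv.
- exact: dot_retained.
- by apply: dot_retained_adjoined => // B; apply: Q4.
- by rewrite dotC; apply: dot_retained_adjoined => // B; apply: Q4.
(* Doubling multiplies the inner product by 4, so the bound 4 on [Q] becomes exactly 16. *)
- rewrite dot_scale2; have : dot q q' <= 4 by apply: hQdot => //; apply: contraNneq uv => ->.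
  by lra.
Qed.

(* One sign of the bundle vector has to be left free to meet the parity; it is put
   outside [supp q] if possible, so that it costs nothing unless [supp q = B]. *)
Lemma exists_bundle_dot q B : q \in Q -> B \in Bs -> (4 < #|supp q :&: B|)%N ->
  exists2 v, bundle eps B v & 16 < dot (2 *: q) v.
Proof.
move=> qQ BB qB; set I := supp q :&: B.
(* The free coordinate [j] lies in [supp q] only when [B] is contained in [supp q], and then the
   intersection has all eight points. *)
have [j jB jI] : exists2 j, j \in B & (j \in I -> #|I| = 8%N).
  have [sqB|/fintype.subsetPn[j jB jq]] := boolP (B \subset supp q).
    have /finset.set0Pn[j jB] : B != finset.set0 by rewrite -card_gt0 hBs8.
    by exists j => // _; rewrite /I (finset.setIidPr sqB) hBs8.
  by exists j => //; rewrite inE (negPf jq).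
(* Negative signs exactly where [q] is negative make every common coordinate contribute 4; [S] then
   corrects the parity at [j] alone. *)
pose N : {set 'I_d} := finset (fun i => (i \in B) && (q 0 i == -1)).
have NB : N \subset B by apply/fintype.subsetP => i; rewrite inE => /andP[].
have [S [SB oS SN]] := exists_parity_subset (eps B == -1) jB NB.
exists (sign_vector R B S).
  by apply/bundle_sign_vector; [| exact: heps | rewrite inE SB oS eqxx].
(* A wrong sign at [j] turns 4 into -4, a loss of 8. The bound is at least 32 - 8 = 24 if [j] is in
   [I], and at least 4 times 5 = 20 otherwise. *)
suff : 4 *+ #|I| - 8 *+ (j \in I) <= dot (2 *: q) (sign_vector R B S).
  apply: lt_le_trans; case: (boolP (j \in I)) => [/jI->|_]; first by rewrite mulr1n -mulr_natr; lra.
  by rewrite mulr0n subr0 -mulr_natr; move: qB; rewrite -(ler_nat R); lra.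
rewrite -sumr_const big_mkcond /=.
(* Writing the loss as a sum concentrated at [j] allows a coordinatewise comparison. *)
have -> : 8 *+ (j \in I) = \sum_i (if i == j then 8 *+ (i \in I) else 0) :> R.
  by rewrite -big_mkcond big_pred1_eq.
rewrite -sumrB; apply: ler_sum => i _; rewrite !mxE /I inE [i \in supp q]inE.
have iSN : i != j -> (i \in S) = (i \in B) && (q 0 i == -1).
  by move=> ij; have /setP/(_ i) := SN; rewrite !inE ij.
case: (boolP (i \in B)) => iB; last by rewrite andbF /= mulr0n mulr0 if_same subr0.
have m10 : (-1 == 0 :> R) = false by rewrite oppr_eq0 oner_eq0.
have m11 : (1 == -1 :> R) = false by rewrite eq_opp oner_eq0.
have [->|ij] := eqVneq i j.
  by case: (hQentries qQ j) => ->; rewrite ?eqxx ?m10 ?oner_eq0; case: (j \in S) => /=; lra.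
rewrite iSN// iB subr0.
case: (hQentries qQ i) => ->; rewrite ?eqxx ?m10 ?m11 ?oner_eq0 /=.
- by case: ifP => _; lra.
- lra.
- lra.
Qed.
End Exchange.
Theorem proposition6p1 (R : realType) (d : nat) (hd : (32 <= d)%N)
  (C : {vspace 'rV['F_2]_32}) (hC : binary_code 32 17 8 C)
  (Bs : {set {set 'I_d}})
  (hBs8 : forall B : {set 'I_d}, B \in Bs -> #|B| = 8%N)
  (hBs4 : forall B B' : {set 'I_d}, B \in Bs -> B' \in Bs -> B != B' ->
     (#|B :&: B'| <= 4)%N)
  (eps : {set 'I_d} -> R)
  (heps : forall B : {set 'I_d}, B \in Bs -> eps B = 1 \/ eps B = -1)
  (Q : {fset 'rV[R]_d})
  (hQentries : forall q : 'rV[R]_d, q \in Q ->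
     forall i, [\/ q 0 i = 0, q 0 i = 1 | q 0 i = -1])
  (hQweight : forall q : 'rV[R]_d, q \in Q -> weight q = 8%N)
  (hQdot : forall q q' : 'rV[R]_d, q \in Q -> q' \in Q -> q != q' -> dot q q' <= 4)
  (Ds : {set {set 'I_d}}) (hDs : Ds \subset Bs) :
  (kissing (exchange C eps Bs Ds Q) /\
   (cardinal (exchange C eps Bs Ds Q))%:Z - (cardinal (configuration C eps Bs))%:Z
     = (#|` Q|)%:Z - 128 * (#|Ds|)%:Z)
  <->
  (forall (q : 'rV[R]_d) (B : {set 'I_d}), q \in Q -> B \in Bs :\: Ds -> (#|supp q :&: B| <= 4)%N).

Proof.
rewrite (cardinal_exchange C Q hDs hBs8 heps); split=> [[[_ kis] cardE] q B qQ BD|Q4].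
  have BB : B \in Bs by move: BD; rewrite inE => /andP[].
  rewrite leqNgt; apply/negP => qB.
  have [v Bv dqv] := exists_bundle_dot hBs8 heps hQentries qQ BB qB.
  have rv := bundle_retained C BD Bv.
  have [qv|qv] := eqVneq (2 *: q) v; last first.
    have : dot (2 *: q) v <= 16 by apply: kis => //; [right; exists q|left].
    by lra.
  (* Here [2 *: q] is itself a retained vector, whereas the cardinality equation forces the overlap
     to have cardinal 0. *)
  have : cardinal ((configuration C eps Bs `\` bundles eps Ds)
      `&` [set 2 *: q | q in [set` Q]])%classic = 0%N by lia.
  move/cardfs0_eq/fset_set_set0 => e0.
  suff : set0 v by [].
  rewrite -e0; first by split=> //; exists q.
  (* Finiteness is essential: [fset_set] is also empty on infinite sets, so cardinal 0 alone would
     not give emptiness. *)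
  exact/finite_setIl/finite_setD/finite_configuration.
split; first exact: (kissing_exchange eps hBs8 hd hBs4 hC hQentries hQweight hQdot Q4).
rewrite (retained_adjoined_disjoint C eps hBs8 hQentries hQweight Q4).
by rewrite /cardinal fset_set0 cardfs0 subr0.
Qed.
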